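(* Let $\Omega=\mathbb{R}$, let $\Theta=\mathbb{R}^d$ be the Euclidean space, and let $(\Omega,\Theta,\rho)$ be a statistical model in which each $\rho(\cdot,\theta)$ is a positive smooth probability density on $\mathbb{R}$. Suppose that for each $\xi\in T_\theta\Theta=\mathbb{R}^d$ the equation $-(\rho(x,\theta)\Phi'(x))'=\langle\nabla_\theta\rho(x,\theta),\xi\rangle$ on $\mathbb{R}$ has a smooth solution $\Phi$ satisfying $$\int_{\mathbb{R}}\rho(x,\theta)|\Phi'(x)|^2dx<+\infty\quad\text{and}\quad\int_{\mathbb{R}}\rho(x,\theta)|\Phi(x)|^2dx<+\infty .$$ Then the Riemannian inner product $g_\theta$ on the Wasserstein statistical manifold $(\Theta,g_\theta)$ has the explicit form $g_\theta(\xi,\eta)=\langle\xi,G_W(\theta)\eta\rangle$ for tangent vectors $\xi,\eta$, where $$G_W(\theta)=\int_{\mathbb{R}}\frac{1}{\rho(x,\theta)}(\nabla_\theta F(x,\theta))^T\nabla_\theta F(x,\theta)\,dx$$ and $F(x,\theta)=\int_{-\infty}^x\rho(y,\theta)\,dy$ is the cumulative distribution function of $\rho(\cdot,\theta)$.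
   Context: A statistical model $(\Omega,\Theta,\rho)$ consists of a sample space $\Omega$, a parameter space $\Theta$, and a map $\theta\mapsto\rho(\cdot,\theta)$ from $\Theta$ into the probability densities on $\Omega$ with finite second moments. Here gradients $\nabla_\theta$ are Euclidean, $\nabla_\theta F$ is written as a row vector, so that $(\nabla_\theta F)^T\nabla_\theta F$ is a $d\times d$ matrix, and $\langle\cdot,\cdot\rangle$ is the Euclidean inner product. A prime denotes the derivative in $x$. The inner product in question is the $L^2$-Wasserstein metric tensor on $\Theta$, defined by $g_\theta(\xi,\eta)=\int_{\mathbb{R}}\rho(x,\theta)\,\Phi_\xi'(x)\Phi_\eta'(x)\,dx$, where $\Phi_\xi$ (and likewise $\Phi_\eta$) is the solution, with the two integrability properties in the claim, of $-(\rho(x,\theta)\Phi_\xi'(x))'=\langle\nabla_\theta\rho(x,\theta),\xi\rangle$. The space $(\Theta,g_\theta)$ is called the Wasserstein statistical manifold.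
   Formalization: The formal theorem additionally assumes that the map from θ to ρ(·,θ) has partial derivatives pointwise and in L^1(R); without regularity in θ the claim fails, since the gradient of F need not equal the integral of the gradient of ρ. *)

(* Defs.v *)
From HB Require Import structures.
From mathcomp Require Import all_boot all_order all_algebra.
From mathcomp Require Import all_classical all_reals all_analysis.
Set Implicit Arguments.
Unset Strict Implicit.
Unset Printing Implicit Defensive.
Import Order.TTheory GRing.Theory Num.Theory.
Import numFieldNormedType.Exports.
Local Open Scope classical_set_scope.
Local Open Scope ring_scope.

(* Parameters theta and tangent vectors xi are column vectors, gradients are
   row vectors; a family of functions on the real line is written
   rho : R -> 'cV[R]_d -> R, with rho x theta = rho(x, theta). *)
Section WassersteinModel.
Variables (R : realType) (d : nat).
Implicit Types (rho : R -> 'cV[R]_d -> R) (theta xi eta : 'cV[R]_d).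
Implicit Types (f Phi Psi : R -> R).
Local Notation mu := (@lebesgue_measure R).

Definition basis_vec (i : 'I_d) : 'cV[R]_d := delta_mx i 0.

Definition gradient (f : 'cV[R]_d -> R) theta : 'rV[R]_d :=
  \row_i 'D_(basis_vec i) f theta.

Definition inner (u v : 'cV[R]_d) : R := \sum_i u i 0 * v i 0.

(* C^oo on the real line *)
Definition smooth f : Prop := forall (n : nat) (x : R), derivable (derive1n n f) x 1.

(* rho(., theta) is a probability density with finite second moment. *)
Definition statistical_model rho : Prop :=
  forall theta,
    [/\ measurable_fun setT (rho ^~ theta),
        forall x, 0 <= rho x theta,
        (\int[mu]_x (rho x theta)%:E = 1)%E
      & (\int[mu]_x (x ^+ 2 * rho x theta)%:E < +oo)%E].

(* The map theta |-> rho(., theta) has partial derivatives, pointwise and in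
   L^1(R). Differentiability in L^1 is what identifies the theta-derivative of
   the cumulative distribution function with the integral of the
   theta-derivative of the density. Joint smoothness of rho in (x, theta) does
   not suffice: if G is a Gaussian distribution function, W = G (1 - G),
   psi s = s / (1 + s^2) and F(x, theta) = G x + W x * psi (theta / W x), then
   at theta = 0 the density has zero theta-derivative although F has
   theta-derivative 1 at every x. *)
Definition L1_differentiable rho : Prop :=
  forall theta (i : 'I_d),
    (forall x, derivable (rho x) theta (basis_vec i)) /\
    (forall e : R, 0 < e -> \forall t \near (0 : R),
      (\int[mu]_x (`|rho x (theta + t *: basis_vec i)%R - rho x theta
                     - t * 'D_(basis_vec i) (rho x) theta|)%:E
         <= (e * `|t|)%:E)%E).

(* Phi is a smooth solution of -(rho Phi')' = <grad_theta rho, xi> satisfying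
   the two integrability conditions; the transpose turns the row gradient into
   a vector of the same kind as xi. *)
Definition potential rho theta xi Phi : Prop :=
  [/\ smooth Phi,
      forall x, - derive1 (fun y => rho y theta * derive1 Phi y) x
                = inner (gradient (rho x) theta)^T xi,
      (\int[mu]_x (rho x theta * `|derive1 Phi x| ^+ 2)%:E < +oo)%E
    & (\int[mu]_x (rho x theta * `|Phi x| ^+ 2)%:E < +oo)%E].

(* A solution for the tangent vector xi; the default value 0 is only used if
   there is none. Solutions are unique up to an additive constant, so the
   choice does not affect the derivative. *)
Definition Phi_of rho theta xi : R -> R :=
  xget (fun=> 0) [set Phi | potential rho theta xi Phi].

Definition wasserstein_metric rho theta xi eta : R :=
  \int[mu]_x (rho x theta
    * derive1 (Phi_of rho theta xi) x
    * derive1 (Phi_of rho theta eta) x).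

Definition model_cdf rho (x : R) theta : R :=
  \int[mu]_(y in `]-oo, x]) rho y theta.

Definition G_W_integrand rho theta (x : R) : 'M[R]_d :=
  (rho x theta)^-1 *:
    ((gradient (model_cdf rho x) theta)^T *m gradient (model_cdf rho x) theta).

Definition G_W rho theta : 'M[R]_d :=
  \matrix_(i, j) \int[mu]_x (G_W_integrand rho theta x i j).

End WassersteinModel.

(* Main.v *)
(* Write p = rho(., theta) and f = <grad_theta rho, xi>. The potential equation
   says that p Phi' + int_{-oo}^x f is a constant c. The integral tends to 0 at
   -oo, so p Phi' tends to c there; since int (p Phi')^2 / p is finite while
   int p^-1 diverges near -oo (as p^-1 >= 2 - p and p is integrable), c = 0.
   Differentiability in L^1 identifies int_{-oo}^x f with <grad_theta F, xi>,
   hence p Phi' = - <grad_theta F, xi>, and p Phi' Psi' is the quadratic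
   expression in grad_theta F. *)
Require Import Defs.
From HB Require Import structures.
From mathcomp Require Import all_boot all_order all_algebra.
From mathcomp Require Import all_classical all_reals all_analysis.
From mathcomp Require Import measurable_realfun.
From mathcomp Require Import ring lra.
Import Order.TTheory GRing.Theory Num.Theory.
Import numFieldNormedType.Exports.
Local Open Scope classical_set_scope.
Local Open Scope ring_scope.

Local Notation mu := (@lebesgue_measure _).

(** * Integrals over half-lines and the vanishing of the constant of integration *)

Lemma Rintegral_sum d (T : measurableType d) (R : realType)
    (m : {measure set T -> \bar R}) (D : set T) (I : Type) (s : seq I)
    (f : I -> T -> R) :
  measurable D -> (forall i, m.-integrable D (EFin \o f i)) ->
  \int[m]_(x in D) (\sum_(i <- s) f i x)
    = \sum_(i <- s) \int[m]_(x in D) f i x.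
Proof.
move=> mD intf; elim: s => [|i s IHs].
  rewrite big_nil; under eq_Rintegral do rewrite big_nil.
  by rewrite Rintegral_cst// mul0r.
rewrite big_cons -IHs -RintegralD//.
  by apply: eq_Rintegral => x _; rewrite big_cons.
rewrite (_ : EFin \o _ = fun x => (\sum_(j <- s) (EFin \o f j) x)%E).
  exact: integrable_sum.
by apply/funext => x /=; rewrite sumEFin.
Qed.

(** Dominated convergence along an arbitrary sequence [u] tending to -oo: the restrictions of [f] to
    the half-lines are bounded by |f|, and at each point they are eventually 0. *)
Lemma cvg_Rintegral_itvNyc (R : realType) (f : R -> R) :
  mu.-integrable setT (EFin \o f) ->
  \int[mu]_(t in `]-oo, x]) f t @[x --> -oo] --> (0 : R).
Proof.
move=> intf; apply/cvg_ninftyP => u uNy.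
have mf : measurable_fun setT f.
  by apply/measurable_EFinP; case/integrableP: intf.
pose f_ n := EFin \o (f \_ `]-oo, u n]).
have mf_ n : measurable_fun setT (f_ n).
  apply/measurable_EFinP; apply/(measurable_restrictT f) => //.
  exact: measurable_funS mf.
have f_cvg x : f_ n x @[n --> \oo] --> cst 0%E x.
  apply: cvg_near_cst; near=> n.
  rewrite /f_ /= patchE memNset//= in_itv/= => /le_lt_trans/(_ _)/negP.
  have un : u n < x by near: n; move/cvgrNy_lt : uNy; exact.
  by move=> /(_ _ un); rewrite ltxx.
have f_le n x : (`|f_ n x| <= `|(f x)%:E|)%E.
  by rewrite /f_ /= lee_fin patchE; case: ifP => // _; rewrite normr0.
have [||//||_ _] := @dominated_convergence _ _ R mu setT measurableT f_
  (cst 0%E) (abse \o (EFin \o f)) mf_.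
- exact: measurable_cst.
- by apply: aeW => x _; exact: f_cvg.
- exact: integrable_abse.
- by apply: aeW => x n _; exact: f_le.
rewrite integral0 => /fine_cvgP[_].
rewrite (_ : _ \o _ = fun n => \int[mu]_(t in `]-oo, u n]) f t)//.
by apply/funext => n /=; rewrite Rintegral_mkcond.
Unshelve. all: by end_near. Qed.

(* Where [u ^+ 2 >= k], one has [2 * k <= u ^+ 2 / p + k * p] because
   [2 <= p^-1 + p]; the right-hand side is integrable. *)
Lemma cvg_Ny_integrable_sqr_div_eq0 (R : realType) (p u : R -> R) (c : R) :
  (forall x, 0 < p x) -> mu.-integrable setT (EFin \o p) ->
  mu.-integrable setT (fun x => (u x ^+ 2 / p x)%:E) ->
  u x @[x --> -oo] --> c -> c = 0.
Proof.
move=> p0 intp intu uc; apply/eqP/negPn/negP => c0.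
(* Once |c - u| <= |c| / 2, the triangle inequality gives |u| >= |c| / 2, so [k] bounds u^2 from
   below near -oo. *)
pose k := (c / 2) ^+ 2.
have k0 : 0 < k by rewrite exprn_even_gt0//= mulf_neq0.
have : \forall x \near -oo, k <= u x ^+ 2.
  have c20 : 0 < `|c| / 2 by rewrite divr_gt0// normr_gt0.
  move/cvgrPdist_le : uc => /(_ _ c20); apply: filterS => x ucx.
  rewrite /k -(real_normK (num_real (c / 2))) -(real_normK (num_real (u x))).
  rewrite lerXn2r ?nnegrE// normrM [`|2^-1|]ger0_norm//.
  by have := ler_normD (c - u x) (u x); rewrite subrK; lra.
move=> [A [_ Au]].
have mI : measurable (`]-oo, A[%classic : set R) by exact: measurable_itv.
have intg : mu.-integrable `]-oo, A[
    (fun x => (u x ^+ 2 / p x)%:E + (k%:E * (p x)%:E))%E.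
  apply: (@integrableS _ _ _ _ setT) => //.
  by apply: integrableD => //; exact: integrableZl.
have : (\int[mu]_(x in `]-oo, A[) cst (2 * k)%:E x
       <= \int[mu]_(x in `]-oo, A[)
            ((u x ^+ 2 / p x)%:E + (k%:E * (p x)%:E)))%E.
  apply: ge0_le_integral => //.
  - by move=> x _; rewrite lee_fin mulr_ge0// ltW.
  - by case/integrableP: intg.
  - move=> x /=; rewrite in_itv/= => /Au kx.
    rewrite -EFinM -EFinD lee_fin.
    apply: (@le_trans _ _ (k / p x + k * p x)).
      rewrite -mulrDr mulrC ler_pM2l//.
      rewrite -(ler_pM2r (p0 x)) [leRHS]mulrDl mulVf ?gt_eqF//.
      by have := sqr_ge0 (p x - 1); nra.
    by rewrite lerD2r ler_wpM2r// invr_ge0 ltW.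
have k20 : 0 < 2 * k by rewrite pmulr_rgt0.
(* A positive constant has infinite integral over a half-line, against the integrability of the
   upper bound. *)
rewrite integral_cst//= lebesgue_measure_itv/= ltNyr/= mulry gtr0_sg//.
rewrite mul1e leye_eq => /eqP gy.
by have := @integrable_lty _ _ R mu _ mI _ intg; rewrite gy.
Qed.

(** For the flux u = p Phi' the quantity u^2 / p is the energy density p Phi'^2. Finite energy thus
    singles out, among the antiderivatives of -f, the one vanishing at -oo. *)
Lemma flux_eq_Rintegral (R : realType) (p u f : R -> R) :
  (forall x, 0 < p x) -> mu.-integrable setT (EFin \o p) ->
  mu.-integrable setT (fun x => (u x ^+ 2 / p x)%:E) ->
  continuous f -> mu.-integrable setT (EFin \o f) ->
  (forall x : R, is_derive x 1 u (- f x)) ->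
  forall x, u x = - \int[mu]_(t in `]-oo, x]) f t.
Proof.
move=> p0 intp intu cf intf du.
pose H x : R := \int[mu]_(t in `]-oo, x]) f t.
have dH (x : R) : is_derive x 1 H (f x).
  (* Any right endpoint beyond [x] would do; [x + 1] makes [x] an interior point. *)
  have [|||dHx eqx] := @continuous_FTC1 _ f -oo%O x (x + 1) _ _ _ (cf x).
  - by rewrite ltrDl.
  - exact: integrableS intf.
  - by rewrite ltNyr.
  - by split => //; rewrite -derive1E.
have uHcst x y : u x + H x = u y + H y.
  apply: (@is_derive_0_is_cst _ (u + H)) => z.
  by rewrite -(addNr (f z)); exact: (is_deriveD (du z) (dH z)).
have cH := cvg_Rintegral_itvNyc R f intf.
have uE : (fun x => u 0 + H 0 - H x) = u.
  by apply/funext => x; rewrite (uHcst 0 x) addrK.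
have : u 0 + H 0 - H x @[x --> -oo] --> u 0 + H 0 - 0.
  by apply: cvgB => //; exact: cvg_cst.
rewrite uE subr0 => uc.
move=> x; apply/eqP; rewrite -addr_eq0 -/(H x) (uHcst x 0); apply/eqP.
exact: cvg_Ny_integrable_sqr_div_eq0 p0 intp intu uc.
Qed.

(** * Differentiating the distribution function in theta *)

Lemma integrable_density (R : realType) (d : nat) (rho : R -> 'cV[R]_d -> R)
    (theta : 'cV[R]_d) :
  statistical_model rho -> mu.-integrable setT (EFin \o rho ^~ theta).
Proof.
move=> /(_ theta)[mrho rho0 rho1 _]; apply/integrableP; split.
  exact/measurable_EFinP.
under eq_integral do rewrite /= ger0_norm//.
by rewrite rho1 ltry.
Qed.

Lemma inner_gradient_basis_vec (R : realType) (d : nat) (f : 'cV[R]_d -> R)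
    (theta : 'cV[R]_d) (i : 'I_d) :
  inner (gradient f theta)^T (basis_vec R i) = 'D_(basis_vec R i) f theta.
Proof.
rewrite /inner (bigD1 i)//= big1 => [|j ji].
  by rewrite addr0 !mxE !eqxx mulr1.
by rewrite /basis_vec !mxE (negbTE ji) mulr0.
Qed.

(** A single nonzero step [t] with L^1 remainder [r] suffices: the partial derivative is then t^-1
    times a combination of two densities and [r], all integrable. *)
Lemma integrable_partial (R : realType) (d : nat) (rho : R -> 'cV[R]_d -> R)
    (theta : 'cV[R]_d) (i : 'I_d) :
  statistical_model rho -> L1_differentiable rho ->
  measurable_fun setT (fun x => 'D_(basis_vec R i) (rho x) theta) ->
  mu.-integrable setT (fun x => ('D_(basis_vec R i) (rho x) theta)%:E).
Proof.
move=> hmodel /(_ theta i)[_ /(_ 1 ltr01)] [e /= e0 eP] mD.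
(* Half the radius is an admissible step different from 0. *)
have te : ball_ (fun x : R => `|x|) 0 e (e / 2).
  by rewrite /ball_/= sub0r normrN gtr0_norm ?divr_gt0//; lra.
have {eP te} := eP _ te; set t := e / 2 => tP.
have t0 : t != 0 by rewrite gt_eqF// divr_gt0.
have irho := integrable_density _ _ rho _ hmodel.
pose r x := rho x (theta + t *: basis_vec R i) - rho x theta
            - t * 'D_(basis_vec R i) (rho x) theta.
have mrho th : measurable_fun setT (rho ^~ th) by case: (hmodel th).
have ir : mu.-integrable setT (EFin \o r).
  apply/integrableP; split.
    apply/measurable_EFinP; apply: measurable_funB.
      exact: (measurable_funB (mrho _) (mrho _)).
    exact: measurable_funM.
  by apply: le_lt_trans tP _; rewrite ltry.
have -> : (fun x => ('D_(basis_vec R i) (rho x) theta)%:E) =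
    (fun x => (t^-1)%:E *
      ((EFin \o rho ^~ (theta + t *: basis_vec R i)%R) x
       - (EFin \o rho ^~ theta) x - (EFin \o r) x))%E.
  apply/funext => x /=; rewrite -!EFinB -EFinM; congr EFin.
  by rewrite /r; field.
apply: integrableZl => //; apply: integrableB => //.
exact: integrableB.
Qed.

(** Integration over a half-line is a linear functional of norm at most 1 on L^1, so it carries the
    L^1 derivative of the density to a derivative of F. *)
Lemma is_derive_model_cdf (R : realType) (d : nat) (rho : R -> 'cV[R]_d -> R)
    (theta : 'cV[R]_d) (i : 'I_d) (x : R) :
  statistical_model rho -> L1_differentiable rho ->
  measurable_fun setT (fun y => 'D_(basis_vec R i) (rho y) theta) ->
  is_derive theta (basis_vec R i) (model_cdf rho x)
    (\int[mu]_(y in `]-oo, x]) 'D_(basis_vec R i) (rho y) theta).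
Proof.
move=> hmodel hdiff mD.
have iD := integrable_partial _ _ _ _ _ hmodel hdiff mD.
have irho th : mu.-integrable setT (EFin \o rho ^~ th).
  exact: integrable_density.
have mI : measurable (`]-oo, x]%classic : set R) by exact: measurable_itv.
have irhoI th : mu.-integrable `]-oo, x] (EFin \o rho ^~ th).
  exact: integrableS (irho th).
have iDI : mu.-integrable `]-oo, x]
    (EFin \o (fun y => 'D_(basis_vec R i) (rho y) theta)).
  exact: integrableS iD.
set l := Rintegral _ _ _.
suff cvgl : h^-1 *: (model_cdf rho x (h *: basis_vec R i + theta)
                     - model_cdf rho x theta) @[h --> 0^'] --> l.
  by split; [apply/cvg_ex; exists l | apply: cvg_lim].
apply/cvgrPdist_le => e e0.
have [_ /(_ _ e0) hd] := hdiff theta i.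
near=> h.
have h0 : h != 0 by near: h; exact: nbhs_dnbhs_neq.
have hP : (\int[mu]_y (`|rho y (theta + h *: basis_vec R i)%R - rho y theta
   - h * 'D_(basis_vec R i) (rho y) theta|)%:E <= (e * `|h|)%:E)%E.
  by near: h; exact: nbhs_dnbhs.
rewrite distrC.
(* By linearity the error of the difference quotient is the integrated L^1 remainder divided by
   [h]. *)
have -> : h^-1 *: (model_cdf rho x (h *: basis_vec R i + theta)
                   - model_cdf rho x theta) - l =
    h^-1 * \int[mu]_(y in `]-oo, x]) (rho y (theta + h *: basis_vec R i)
      - rho y theta - h * 'D_(basis_vec R i) (rho y) theta).
  rewrite RintegralB//; last 2 first.
  - have := integrableB _ (irhoI (theta + h *: basis_vec R i)) (irhoI theta).
    exact.
  - by have := integrableZl _ h iDI; exact.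
  by rewrite RintegralB// RintegralZl// mulrBr mulKf// [theta + _]addrC.
pose D y := rho y (theta + h *: basis_vec R i) - rho y theta
            - h * 'D_(basis_vec R i) (rho y) theta.
have iD' : mu.-integrable setT (EFin \o D).
  have := integrableB _ (integrableB _ (irho (theta + h *: basis_vec R i))
    (irho theta)) (integrableZl _ h iD).
  exact.
(* The half-line integral of the remainder is at most its L^1 norm over the whole line, hence at
   most e |h|. *)
rewrite normrM normfV ler_pdivrMl ?normr_gt0// -lee_fin mulrC.
apply: le_trans hP.
rewrite EFin_normr_Rintegral//; last exact: integrableS iD'.
apply: (le_trans (le_abse_integral mu _ _)) => //.
  by have /integrableP[mD' _] := iD'; exact: measurable_funS mD'.
apply: ge0_subset_integral => //.
by have /integrableP[mD' _] := iD'; exact: measurableT_comp.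
Unshelve. all: by end_near. Qed.

(** * Regularity, energy and flux of a potential *)

Lemma smooth_continuous_derive (R : realType) (f : R -> R) :
  smooth f -> continuous f /\ continuous (derive1 f).
Proof.
by move=> sf; split=> x; apply: differentiable_continuous;
  apply/derivable1_diffP; [exact: (sf 0) | exact: (sf 1)].
Qed.

(** The equation only prescribes the value of [derive1]; that the derivative exists comes from the
    smoothness of both factors. *)
Lemma potential_flux_is_derive (R : realType) (d : nat)
    (rho : R -> 'cV[R]_d -> R) (theta xi : 'cV[R]_d) (Phi : R -> R) (x : R) :
  smooth (rho ^~ theta) -> potential rho theta xi Phi ->
  is_derive x 1 (fun y => rho y theta * derive1 Phi y)
    (- inner (gradient (rho x) theta)^T xi).
Proof.
move=> srho [sPhi eqPhi _ _]; rewrite -eqPhi opprK derive1E.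
by apply: derivableP; apply: derivableM; [exact: (srho 0) | exact: (sPhi 1)].
Qed.

(** Regularity in x of the theta-gradient is read off from the equation: the source equals -(rho
    Phi'' + rho' Phi'). This serves the fundamental theorem of calculus and the measurability of the
    partial derivatives. *)
Lemma potential_source_continuous (R : realType) (d : nat)
    (rho : R -> 'cV[R]_d -> R) (theta xi : 'cV[R]_d) (Phi : R -> R) :
  smooth (rho ^~ theta) -> potential rho theta xi Phi ->
  continuous (fun x => inner (gradient (rho x) theta)^T xi).
Proof.
move=> srho [sPhi eqPhi _ _].
have [crho crho'] := smooth_continuous_derive _ _ srho.
have [_ cPhi'] := smooth_continuous_derive _ _ sPhi.
have cPhi'' : continuous (derive1 (derive1 Phi)).
  by move=> x; apply: differentiable_continuous; apply/derivable1_diffP;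
    exact: (sPhi 2).
rewrite (_ : (fun x => _) = fun x =>
    - (rho x theta * derive1 (derive1 Phi) x
       + derive1 Phi x * derive1 (rho ^~ theta) x)); last first.
  apply/funext => x; rewrite -eqPhi derive1E.
  rewrite (@deriveM _ _ (rho ^~ theta) (derive1 Phi)) -?derive1E//.
    exact: (srho 0).
  exact: (sPhi 1).
move=> x; apply: (@continuousN _ _ _ (fun x =>
  rho x theta * derive1 (derive1 Phi) x
  + derive1 Phi x * derive1 (rho ^~ theta) x)).
exact: (continuousD (continuousM (crho x) (cPhi'' x))
  (continuousM (cPhi' x) (crho' x))).
Qed.

Lemma potential_energy_integrable (R : realType) (d : nat)
    (rho : R -> 'cV[R]_d -> R) (theta xi : 'cV[R]_d) (Phi : R -> R) :
  (forall y, 0 < rho y theta) -> smooth (rho ^~ theta) ->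
  potential rho theta xi Phi ->
  mu.-integrable setT
    (fun x => (rho x theta * derive1 Phi x ^+ 2)%:E).
Proof.
move=> p0 srho [sPhi _ fin_energy _].
have [crho _] := smooth_continuous_derive _ _ srho.
have [_ cPhi'] := smooth_continuous_derive _ _ sPhi.
apply/integrableP; split.
  apply/measurable_EFinP; apply: measurable_funM.
    exact: continuous_measurable_fun.
  by apply: measurable_funX; exact: continuous_measurable_fun.
under eq_integral => y _ do
  rewrite /= normrM normrX (gtr0_norm (p0 y)).
exact: fin_energy.
Qed.

(** Weighted by rho, |Phi' Psi'| <= Phi'^2 + Psi'^2 bounds the pairing by the two energies. *)
Lemma potential_energy_pairing_integrable (R : realType) (d : nat)
    (rho : R -> 'cV[R]_d -> R) (theta xi eta : 'cV[R]_d) (Phi Psi : R -> R) :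
  (forall y, 0 < rho y theta) -> smooth (rho ^~ theta) ->
  potential rho theta xi Phi -> potential rho theta eta Psi ->
  mu.-integrable setT
    (fun x => (rho x theta * derive1 Phi x * derive1 Psi x)%:E).
Proof.
move=> p0 srho potPhi potPsi.
have [crho _] := smooth_continuous_derive _ _ srho.
have [_ cPhi'] : continuous Phi /\ continuous (derive1 Phi).
  by apply: smooth_continuous_derive; case: potPhi.
have [_ cPsi'] : continuous Psi /\ continuous (derive1 Psi).
  by apply: smooth_continuous_derive; case: potPsi.
apply: (@le_integrable _ _ R mu setT measurableT _ (fun x =>
  ((rho x theta * derive1 Phi x ^+ 2)%:E
   + (rho x theta * derive1 Psi x ^+ 2)%:E)%E)).
- apply/measurable_EFinP; apply: measurable_funM.
    by apply: measurable_funM; exact: continuous_measurable_fun.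
  exact: continuous_measurable_fun.
- move=> x _; rewrite -EFinD !abse_EFin lee_fin -mulrA -mulrDr !normrM.
  rewrite ler_wpM2l// -normrM [leRHS]ger0_norm ?addr_ge0 ?sqr_ge0//.
  rewrite ler_norml; apply/andP; split.
    have := sqr_ge0 (derive1 Phi x + derive1 Psi x).
    by have := sqr_ge0 (derive1 Phi x); have := sqr_ge0 (derive1 Psi x); nra.
  have := sqr_ge0 (derive1 Phi x - derive1 Psi x).
  by have := sqr_ge0 (derive1 Phi x); have := sqr_ge0 (derive1 Psi x); nra.
- by apply: integrableD => //;
    [exact: potential_energy_integrable potPhi
    |exact: potential_energy_integrable potPsi].
Qed.

Lemma potential_flux (R : realType) (d : nat)
    (rho : R -> 'cV[R]_d -> R) (theta xi : 'cV[R]_d) (Phi : R -> R) (x : R) :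
  statistical_model rho -> (forall y, 0 < rho y theta) ->
  smooth (rho ^~ theta) ->
  mu.-integrable setT
    (fun y => (inner (gradient (rho y) theta)^T xi)%:E) ->
  potential rho theta xi Phi ->
  rho x theta * derive1 Phi x
    = - \int[mu]_(y in `]-oo, x]) inner (gradient (rho y) theta)^T xi.
Proof.
move=> hmodel p0 srho isrc pot.
apply: (flux_eq_Rintegral _ (rho ^~ theta)
  (fun y => rho y theta * derive1 Phi y)) => //.
- exact: integrable_density.
- have := potential_energy_integrable _ _ _ _ _ _ p0 srho pot.
  apply: eq_integrable => //.
  by move=> y _; congr EFin; field; rewrite gt_eqF.
- exact: potential_source_continuous srho pot.
- by move=> y; exact: potential_flux_is_derive.
Qed.

(** * From sources to the gradient of F and the matrix entries *)

Lemma bilinear_G_W_integrand (R : realType) (d : nat)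
    (rho : R -> 'cV[R]_d -> R) (theta xi eta : 'cV[R]_d) (x : R) :
  (rho x theta)^-1 * inner (gradient (model_cdf rho x) theta)^T xi
    * inner (gradient (model_cdf rho x) theta)^T eta
  = \sum_i \sum_j xi i 0 * eta j 0 * G_W_integrand rho theta x i j.
Proof.
rewrite /G_W_integrand; move: (gradient _ _) (rho x theta)^-1 => G q.
rewrite -mulrA /inner mulr_suml mulr_sumr; apply: eq_bigr => i _.
rewrite mulr_sumr mulr_sumr; apply: eq_bigr => j _.
by rewrite !mxE big_ord1 !mxE; ring.
Qed.

Lemma Rintegral_source (R : realType) (d : nat)
    (rho : R -> 'cV[R]_d -> R) (theta xi : 'cV[R]_d) (x : R) :
  statistical_model rho -> L1_differentiable rho ->
  (forall i, measurable_fun setT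
     (fun y => 'D_(basis_vec R i) (rho y) theta)) ->
  \int[mu]_(y in `]-oo, x]) inner (gradient (rho y) theta)^T xi
    = inner (gradient (model_cdf rho x) theta)^T xi.
Proof.
move=> hmodel hdiff mD.
have mI : measurable (`]-oo, x]%classic : set R) by exact: measurable_itv.
have iD i : mu.-integrable `]-oo, x]
    (EFin \o (fun y => 'D_(basis_vec R i) (rho y) theta)).
  by apply: (integrableS measurableT) => //; exact: integrable_partial.
rewrite /inner Rintegral_sum//; last first.
  move=> i; have := @integrableZr _ _ R mu _ mI (xi i 0) _ (iD i).
  by apply: eq_integrable => // y _ /=; rewrite !mxE.
apply: eq_bigr => i _.
rewrite !mxE (@derive_val _ _ _ _ _ _ _
  (is_derive_model_cdf _ _ _ _ i x hmodel hdiff (mD i))).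
by rewrite -RintegralZr//; apply: eq_Rintegral => y _; rewrite !mxE.
Qed.

Lemma integrable_source (R : realType) (d : nat)
    (rho : R -> 'cV[R]_d -> R) (theta xi : 'cV[R]_d) :
  statistical_model rho -> L1_differentiable rho ->
  (forall i, measurable_fun setT
     (fun y => 'D_(basis_vec R i) (rho y) theta)) ->
  mu.-integrable setT (fun y => (inner (gradient (rho y) theta)^T xi)%:E).
Proof.
move=> hmodel hdiff mD.
rewrite (_ : (fun y => _) = fun y =>
    (\sum_i (xi i 0)%:E * ('D_(basis_vec R i) (rho y) theta)%:E)%E).
  apply: integrable_sum => // i _.
  by apply: integrableZl => //; exact: integrable_partial.
apply/funext => y; rewrite /inner -sumEFin; apply: eq_bigr => i _.
by rewrite !mxE mulrC EFinM.
Qed.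

Theorem proposition5 (R : realType) (d : nat) (rho : R -> 'cV[R]_d -> R)
  (hmodel : statistical_model rho)
  (hpos : forall x theta, 0 < rho x theta)
  (hsmooth : forall theta, smooth (rho ^~ theta))
  (hdiff : L1_differentiable rho)
  (hsol : forall theta xi, exists Phi, potential rho theta xi Phi) :
  forall theta : 'cV[R]_d,
    (* the gradient of F exists and the integral defining G_W converges *)
    (forall x i, derivable (model_cdf rho x) theta (basis_vec R i)) /\
    (forall i j, (@lebesgue_measure R).-integrable setT
       (fun x => (G_W_integrand rho theta x i j)%:E)) /\
    (* g_theta is well defined: it does not depend on the chosen solutions *)
    (forall (xi eta : 'cV[R]_d) (Phi Psi : R -> R),
       potential rho theta xi Phi -> potential rho theta eta Psi ->
       (@lebesgue_measure R).-integrable setT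
         (fun x => (rho x theta * derive1 Phi x * derive1 Psi x)%:E) /\
       wasserstein_metric rho theta xi eta
         = \int[@lebesgue_measure R]_x (rho x theta * derive1 Phi x * derive1 Psi x)) /\
    (* the explicit form *)
    (forall xi eta : 'cV[R]_d,
       wasserstein_metric rho theta xi eta
         = inner xi (G_W rho theta *m eta)).
Proof.
move=> theta.
have p0 y : 0 < rho y theta by exact: hpos.
(* The i-th partial derivative is the source for the i-th basis vector, which is continuous because
   a potential exists for it. *)
have mD i : measurable_fun setT (fun y => 'D_(basis_vec R i) (rho y) theta).
  have [Phi pot] := hsol theta (basis_vec R i).
  apply: continuous_measurable_fun.
  rewrite (_ : (fun y => _) = fun y =>
      inner (gradient (rho y) theta)^T (basis_vec R i)); last first.
    by apply/funext => y; rewrite inner_gradient_basis_vec.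
  exact: potential_source_continuous (hsmooth theta) pot.
pose gF x := (gradient (model_cdf rho x) theta)^T.
have fluxE xi Phi x : potential rho theta xi Phi ->
    rho x theta * derive1 Phi x = - inner (gF x) xi.
  move=> pot; rewrite -Rintegral_source//.
  by apply: potential_flux => //; exact: integrable_source.
(* The pairing is rho^-1 times the product of the two fluxes, whose minus signs cancel. The
   right-hand side no longer mentions the potentials, which gives independence of their choice. *)
have pairingE xi eta Phi Psi x :
    potential rho theta xi Phi -> potential rho theta eta Psi ->
    rho x theta * derive1 Phi x * derive1 Psi x
    = (rho x theta)^-1 * inner (gF x) xi * inner (gF x) eta.
  move=> potPhi potPsi.
  rewrite -mulrA -[LHS](mulKf (lt0r_neq0 (p0 x))) -[RHS]mulrA; congr (_ * _).
  by rewrite -[RHS]mulrNN -(fluxE xi Phi)// -(fluxE eta Psi)//; ring.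
(* Existence of a solution rules out the default value of [xget]. *)
have potPhi_of xi : potential rho theta xi (Phi_of rho theta xi).
  by have [Phi pot] := hsol theta xi; exact: (xgetPex _ (ex_intro _ Phi pot)).
have metricE xi eta : wasserstein_metric rho theta xi eta
    = \int[mu]_x ((rho x theta)^-1 * inner (gF x) xi * inner (gF x) eta).
  by apply: eq_Rintegral => x _; exact: pairingE.
(* Entry (i, j) is the energy pairing of the potentials of two basis vectors, so finite energy makes
   [G_W] converge. *)
have iG i j : mu.-integrable setT
    (fun x => (G_W_integrand rho theta x i j)%:E).
  have := potential_energy_pairing_integrable _ _ _ _ _ _ _ _ p0
    (hsmooth theta) (potPhi_of (basis_vec R i)) (potPhi_of (basis_vec R j)).
  apply: eq_integrable => // x _; congr EFin.
  rewrite (pairingE (basis_vec R i) (basis_vec R j))//.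
  by rewrite !inner_gradient_basis_vec !mxE big_ord1 !mxE mulrA.
split.
  move=> x i.
  by have [] := is_derive_model_cdf _ _ _ theta i x hmodel hdiff (mD i).
split; first exact: iG.
split=> [xi eta Phi Psi potPhi potPsi|xi eta].
  split; first exact: potential_energy_pairing_integrable potPhi potPsi.
  rewrite metricE; apply: eq_Rintegral => x _.
  by rewrite (pairingE xi eta).
rewrite metricE.
(* Expanding into entries before integrating lets [iG] justify the exchange of integral and double
   sum. *)
under eq_Rintegral do rewrite bilinear_G_W_integrand.
have iZ i j : mu.-integrable setT (EFin \o (fun x =>
    xi i 0 * eta j 0 * G_W_integrand rho theta x i j)).
  exact: (@integrableZl _ _ R mu _ measurableT _ _ (iG i j)).
rewrite Rintegral_sum//; last first.
  move=> i; rewrite (_ : EFin \o _ = fun x => (\sum_j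
    (xi i 0 * eta j 0 * G_W_integrand rho theta x i j)%:E)%E).
    by apply: integrable_sum => // j _; exact: iZ.
  by apply/funext => x /=; rewrite sumEFin.
apply: eq_bigr => i _; rewrite Rintegral_sum// mxE mulr_sumr.
apply: eq_bigr => j _; rewrite RintegralZl//; last exact: iG.
by rewrite [G_W _ _ i j]mxE mulrAC -mulrA.
Qed.
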